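(* Each pseudo-exponential potential $v(x)$ tends to zero when $x$ tends to infinity.
   Context: Let $m_1,m_2\in\mathbb{N}$, $j=\mathrm{diag}\{I_{m_1},-I_{m_2}\}$. $X>0$ means that $X$ is Hermitian with all eigenvalues positive. For $n\in\mathbb{N}$, a quadruple $\{\alpha,S_0,\vartheta_1,\vartheta_2\}$ of complex $n\times n$ matrices $\alpha,S_0$ and $n\times m_k$ matrices $\vartheta_k$ ($k=1,2$) is admissible if $S_0>0$ and $$\alpha S_0-S_0\alpha^*=\mathrm{i}(\vartheta_1\vartheta_1^*+\vartheta_2\vartheta_2^* ).$$ An $m_1\times m_2$ matrix function $v$ on $[0,\infty)$ is a pseudo-exponential potential if it is generated by some admissible quadruple (for some $n\in\mathbb{N}$), i.e. $$v(x)=2\vartheta_1^*\mathrm{e}^{\mathrm{i}x\alpha^*}S(x)^{-1}\mathrm{e}^{\mathrm{i}x\alpha}\vartheta_2,$$ where $$S(x)=S_0+\int_0^x\Lambda(t)j\Lambda(t)^*\,dt,\qquad \Lambda(x)=\begin{bmatrix}\mathrm{e}^{-\mathrm{i}x\alpha}\vartheta_1 & \mathrm{e}^{\mathrm{i}x\alpha}\vartheta_2\end{bmatrix}.$$ *)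

(* Defs.v *)
From HB Require Import structures.
From mathcomp Require Import all_boot all_order all_algebra.
From mathcomp Require Import spectral complex.
From mathcomp Require Import all_classical all_reals all_analysis.

Set Implicit Arguments.
Unset Strict Implicit.
Unset Printing Implicit Defensive.

Import Order.TTheory GRing.Theory Num.Theory.
Import numFieldNormedType.Exports.

Local Open Scope classical_set_scope.
Local Open Scope ring_scope.
Local Open Scope complex_scope.
Local Open Scope sesquilinear_scope.

(* [complex] comes without a topology. Give R[i] the one induced by its modulus,
   so that the library topology on matrices applies to 'M[R[i]]_(m, n). *)
HB.instance Definition _ (R : rcfType) := NormedModule.copy R[i] R[i]^o.

Section Defs.
Context {R : realType}.

Definition expmx n (A : 'M[R[i]]_n) : 'M[R[i]]_n :=
  limn (series (fun k => k`!%:R^-1 *: A ^+ k)).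

(* The integral from a to b (for a <= b), taken separately on the real and on the imaginary
   part of each entry, with respect to Lebesgue measure. *)
Definition integralmx m n (a b : R) (F : R -> 'M[R[i]]_(m, n)) : 'M[R[i]]_(m, n) :=
  \matrix_(k, l)
    ((\int[lebesgue_measure]_(t in `[a, b]) complex.Re (F t k l))
     +i* (\int[lebesgue_measure]_(t in `[a, b]) complex.Im (F t k l))).

(* For a : R[i], 0 < a means that a is real and positive. *)
Definition posdefmx n (A : 'M[R[i]]_n) : Prop :=
  A \is hermsymmx /\ forall a, eigenvalue A a -> 0 < a.

Definition signmx m1 m2 : 'M[R[i]]_(m1 + m2) := block_mx 1%:M 0 0 (- 1%:M).

Definition admissible n m1 m2 (alpha S0 : 'M[R[i]]_n)
    (theta1 : 'M[R[i]]_(n, m1)) (theta2 : 'M[R[i]]_(n, m2)) : Prop :=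
  posdefmx S0 /\
  alpha *m S0 - S0 *m alpha ^t* =
    'i%C *: (theta1 *m theta1 ^t* + theta2 *m theta2 ^t*).

Definition Lambda n m1 m2 (alpha : 'M[R[i]]_n)
    (theta1 : 'M[R[i]]_(n, m1)) (theta2 : 'M[R[i]]_(n, m2)) (x : R) :
    'M[R[i]]_(n, m1 + m2) :=
  row_mx (expmx ((- ('i%C * x%:C)) *: alpha) *m theta1)
         (expmx (('i%C * x%:C) *: alpha) *m theta2).

Definition Smx n m1 m2 (alpha S0 : 'M[R[i]]_n)
    (theta1 : 'M[R[i]]_(n, m1)) (theta2 : 'M[R[i]]_(n, m2)) (x : R) :
    'M[R[i]]_n :=
  S0 + integralmx 0 x (fun t =>
    Lambda alpha theta1 theta2 t *m signmx m1 m2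
      *m (Lambda alpha theta1 theta2 t) ^t*).

Definition potential n m1 m2 (alpha S0 : 'M[R[i]]_n)
    (theta1 : 'M[R[i]]_(n, m1)) (theta2 : 'M[R[i]]_(n, m2)) (x : R) :
    'M[R[i]]_(m1, m2) :=
  2 *: (theta1 ^t* *m expmx (('i%C * x%:C) *: alpha ^t*)
        *m invmx (Smx alpha S0 theta1 theta2 x)
        *m expmx (('i%C * x%:C) *: alpha) *m theta2).

(* v stands for a function on [0, +oo[; its values at negative reals are
   irrelevant. *)
Definition pseudo_exponential m1 m2 (v : R -> 'M[R[i]]_(m1, m2)) : Prop :=
  exists (n : nat) (alpha S0 : 'M[R[i]]_n)
    (theta1 : 'M[R[i]]_(n, m1)) (theta2 : 'M[R[i]]_(n, m2)),
    admissible alpha S0 theta1 theta2 /\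
    forall x : R, 0 <= x -> v x = potential alpha S0 theta1 theta2 x.

End Defs.

(* Main.v *)
(* Write X^H for the adjoint of X. Conjugating S(x) by e^(-ix alpha) gives Q(x)
   with Q(0) = S_0,
     Q' = 2 w w^H,   alpha Q - Q alpha^H = i (w w^H + theta_2 theta_2^H),
   where w(x) = e^(-2ix alpha) theta_1, and v = 2 b theta_2 with b = w^H Q^(-1).
   Since Q is nondecreasing, Q >= S_0 and P = Q^(-1) is bounded. Tracing the
   identity against P shows that tr (w^H P w) + tr (theta_2^H P theta_2) is
   constant, so b is bounded too. Now P' = -2 b^H b and
   b' = b (2i alpha + 2 theta_2 theta_2^H P), so the diagonal entries of P are
   nonnegative, nonincreasing and have a bounded second derivative; by
   Barbalat's lemma their derivatives -2 sum_k |b_kl|^2 tend to 0. *)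
Require Import Defs.
From mathcomp Require Import all_boot all_order all_algebra.
From mathcomp Require Import perm spectral complex.
From mathcomp Require Import ring lra.
From mathcomp Require Import all_classical all_reals all_analysis.
Import Order.TTheory GRing.Theory Num.Theory.
Import numFieldNormedType.Exports.

Set Implicit Arguments.
Unset Strict Implicit.
Unset Printing Implicit Defensive.

Local Open Scope classical_set_scope.
Local Open Scope ring_scope.
Local Open Scope complex_scope.
Local Open Scope sesquilinear_scope.

(** * Entrywise derivatives of complex matrix functions *)

Section Derivatives.
Context {R : realType}.
Implicit Types (x : R) (f g : R -> R[i]).

(** The variable is real and the values are complex: passing to real and imaginary parts reduces
    every rule to a real [is_derive]. *)
Definition cderiv x f (d : R[i]) : Prop :=
  is_derive x 1 (fun t => complex.Re (f t)) (complex.Re d) /\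
  is_derive x 1 (fun t => complex.Im (f t)) (complex.Im d).

Definition mxderiv x m n (F : R -> 'M[R[i]]_(m, n)) (D : 'M[R[i]]_(m, n)) :=
  forall i j, cderiv x (fun t => F t i j) (D i j).

Lemma cReM (a b : R[i]) :
  complex.Re (a * b) =
    complex.Re a * complex.Re b - complex.Im a * complex.Im b.
Proof. by case: a b => [? ?] [? ?]. Qed.

Lemma cImM (a b : R[i]) :
  complex.Im (a * b) =
    complex.Re a * complex.Im b + complex.Im a * complex.Re b.
Proof. by case: a b => [? ?] [? ?]. Qed.

Lemma cReD (a b : R[i]) : complex.Re (a + b) = complex.Re a + complex.Re b.
Proof. by case: a b => [? ?] [? ?]. Qed.

Lemma cImD (a b : R[i]) : complex.Im (a + b) = complex.Im a + complex.Im b.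
Proof. by case: a b => [? ?] [? ?]. Qed.

Lemma cReJ (a : R[i]) : complex.Re (Num.conj a) = complex.Re a.
Proof. by case: a. Qed.

Lemma cImJ (a : R[i]) : complex.Im (Num.conj a) = - complex.Im a.
Proof. by case: a. Qed.

Lemma complex_ReZ (a : R) (z : R[i]) :
  complex.Re (a%:C * z) = a * complex.Re z.
Proof. by rewrite cReM mul0r subr0. Qed.

Lemma complex_ImZ (a : R) (z : R[i]) :
  complex.Im (a%:C * z) = a * complex.Im z.
Proof. by rewrite cImM mul0r addr0. Qed.

Lemma cderiv_cst x a : cderiv x (fun=> a) 0.
Proof. by split; exact: is_derive_cst. Qed.

Lemma cderivD x f g d e : cderiv x f d -> cderiv x g e ->
  cderiv x (fun t => f t + g t) (d + e).
Proof.
move=> [f1 f2] [g1 g2]; split.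
  by under eq_fun do rewrite cReD; rewrite cReD; exact: is_deriveD.
by under eq_fun do rewrite cImD; rewrite cImD; exact: is_deriveD.
Qed.

Lemma cderivM x f g d e : cderiv x f d -> cderiv x g e ->
  cderiv x (fun t => f t * g t) (d * g x + f x * e).
Proof.
move=> [f1 f2] [g1 g2]; split.
  under eq_fun do rewrite cReM.
  apply: is_derive_eq.
  by rewrite cReD !cReM /GRing.scale/=; ring.
under eq_fun do rewrite cImM.
apply: is_derive_eq.
by rewrite cImD !cImM /GRing.scale/=; ring.
Qed.

Lemma cderivJ x f d : cderiv x f d ->
  cderiv x (fun t => Num.conj (f t)) (Num.conj d).
Proof.
move=> [f1 f2]; split.
  by under eq_fun do rewrite cReJ; rewrite cReJ.
by under eq_fun do rewrite cImJ; rewrite cImJ; exact: is_deriveN.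
Qed.

Lemma cderiv_sum x (I : Type) (r : seq I) (P : pred I)
    (f : I -> R -> R[i]) (d : I -> R[i]) :
  (forall i, P i -> cderiv x (f i) (d i)) ->
  cderiv x (fun t => \sum_(i <- r | P i) f i t) (\sum_(i <- r | P i) d i).
Proof.
move=> H; elim: r => [|i r IH].
  by rewrite big_nil; under eq_fun do rewrite big_nil; exact: cderiv_cst.
rewrite big_cons; under eq_fun do rewrite big_cons.
by case: ifP => // Pi; apply: cderivD => //; exact: H.
Qed.

(** Mere existence suffices for determinants and cofactors; the derivative of an inverse is computed
    afterwards from F F^(-1) = 1. *)
Definition cderivable x f := exists d, cderiv x f d.

Lemma cderivable_sum x (I : Type) (r : seq I) (P : pred I)
    (f : I -> R -> R[i]) :
  (forall i, cderivable x (f i)) ->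
  cderivable x (fun t => \sum_(i <- r | P i) f i t).
Proof.
move=> H; exists (\sum_(i <- r | P i) sval (cid (H i))).
by apply: cderiv_sum => i _; case: cid.
Qed.

Lemma cderivable_prod x (I : Type) (r : seq I) (f : I -> R -> R[i]) :
  (forall i, cderivable x (f i)) ->
  cderivable x (fun t => \prod_(i <- r) f i t).
Proof.
move=> H; elim: r => [|i r [d IH]].
  by exists 0; under eq_fun do rewrite big_nil; exact: cderiv_cst.
have [e He] := H i; exists (e * \prod_(j <- r) f j x + f i x * d).
by under eq_fun do rewrite big_cons; exact: cderivM.
Qed.

Lemma cderivable_inv x f : f x != 0 -> cderivable x f ->
  cderivable x (fun t => (f t)^-1).
Proof.
move=> fx0 [d [f1 f2]].
(* [q] is |f|^2, and 1/f = conj(f) / |f|^2 makes both parts of the inverse real quotients. *)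
pose q t :=
  complex.Re (f t) * complex.Re (f t) + complex.Im (f t) * complex.Im (f t).
have qx0 : q x != 0.
  apply: contra fx0; rewrite /q -!expr2 paddr_eq0 ?sqr_ge0// !sqrf_eq0.
  by case: (f x) => a b /= /andP[/eqP -> /eqP ->].
have dqV := is_deriveV qx0 (is_deriveD (is_deriveM f1 f1) (is_deriveM f2 f2)).
have E : (fun t => (f t)^-1) =
    (fun t =>
      (complex.Re (f t) * (q t)^-1) +i* (- complex.Im (f t) * (q t)^-1)).
  by apply/funext => t; rewrite /q -!expr2 mulNr; case: (f t).
rewrite E; eexists (_ +i* _); split => /=; first exact: (is_deriveM f1 dqV).
exact: (is_deriveM (is_deriveN f2) dqV).
Qed.

(** * Differentiation rules for matrix products, adjoints and inverses *)

Section Matrices.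
Variable x : R.

Lemma mxderiv_eq m n (F G : R -> 'M[R[i]]_(m, n)) D D' :
  F =1 G -> D = D' -> mxderiv x F D -> mxderiv x G D'.
Proof. by move=> /funext -> ->. Qed.

Lemma mxderiv_cst m n (A : 'M[R[i]]_(m, n)) : mxderiv x (fun=> A) 0.
Proof. by move=> i j; rewrite mxE; exact: cderiv_cst. Qed.

Lemma mxderivD m n (F G : R -> 'M[R[i]]_(m, n)) D D' :
  mxderiv x F D -> mxderiv x G D' -> mxderiv x (fun t => F t + G t) (D + D').
Proof.
move=> dF dG i j; rewrite mxE; under eq_fun do rewrite mxE.
exact: cderivD.
Qed.

Lemma mxderivZ m n a (F : R -> 'M[R[i]]_(m, n)) D :
  mxderiv x F D -> mxderiv x (fun t => a *: F t) (a *: D).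
Proof.
move=> dF i j; rewrite mxE; under eq_fun do rewrite mxE.
have := cderivM (cderiv_cst x a) (dF i j).
by rewrite mul0r add0r.
Qed.

Lemma mxderivB m n (F G : R -> 'M[R[i]]_(m, n)) D D' :
  mxderiv x F D -> mxderiv x G D' -> mxderiv x (fun t => F t - G t) (D - D').
Proof.
move=> dF /(mxderivZ (-1)) dG; rewrite -scaleN1r.
by under eq_fun do rewrite -scaleN1r; exact: mxderivD.
Qed.

Lemma mxderivM m n p (F : R -> 'M[R[i]]_(m, n))
    (G : R -> 'M[R[i]]_(n, p)) D D' :
  mxderiv x F D -> mxderiv x G D' ->
  mxderiv x (fun t => F t *m G t) (D *m G x + F x *m D').
Proof.
move=> dF dG i j; rewrite !mxE -big_split/=.
under eq_fun do rewrite mxE.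
by apply: cderiv_sum => k _; exact: cderivM.
Qed.

Lemma mxderivMl m n p (A : 'M[R[i]]_(m, n)) (G : R -> 'M[R[i]]_(n, p)) D :
  mxderiv x G D -> mxderiv x (fun t => A *m G t) (A *m D).
Proof. by move=> /(mxderivM (mxderiv_cst A)); rewrite mul0mx add0r. Qed.

Lemma mxderivMr m n p (F : R -> 'M[R[i]]_(m, n)) (A : 'M[R[i]]_(n, p)) D :
  mxderiv x F D -> mxderiv x (fun t => F t *m A) (D *m A).
Proof.
by move=> dF; have := mxderivM dF (mxderiv_cst A); rewrite mulmx0 addr0.
Qed.

Lemma mxderiv_adj m n (F : R -> 'M[R[i]]_(m, n)) D :
  mxderiv x F D -> mxderiv x (fun t => F t ^t*) (D ^t*).
Proof.
move=> dF i j; rewrite !mxE; under eq_fun do rewrite !mxE.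
exact: cderivJ.
Qed.

Lemma mxderiv_near_eq m n (F G : R -> 'M[R[i]]_(m, n)) D :
  (\forall t \near x, F t = G t) -> mxderiv x F D -> mxderiv x G D.
Proof.
move=> FG dF i j; have [f1 f2] := dF i j.
by split; [apply: near_eq_is_derive f1|apply: near_eq_is_derive f2];
  apply: filterS FG => t ->.
Qed.

(** By Cramer's rule the entries of the inverse are quotients of polynomials in the entries of
    [F]. *)
Lemma mxderivable_inv n (F : R -> 'M[R[i]]_n) D :
  (\forall t \near x, F t \in unitmx) -> mxderiv x F D ->
  exists D', mxderiv x (fun t => invmx (F t)) D'.
Proof.
move=> Fu dF.
have dcol (f : 'I_n -> 'I_n -> R -> R[i]) :
    (forall i j, cderivable x (f i j)) ->
    exists D : 'M[R[i]]_n, mxderiv x (fun t => \matrix_(i, j) f i j t) D.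
  move=> H; exists (\matrix_(i, j) sval (cid (H i j))) => i j.
  rewrite mxE; under eq_fun do rewrite mxE.
  by case: cid.
have ddet p (G : R -> 'M[R[i]]_p) :
    (forall i j, cderivable x (fun t => G t i j)) ->
    cderivable x (fun t => \det (G t)).
  move=> dG; apply: cderivable_sum => s.
  have [d Hd] := cderivable_prod (index_enum 'I_p) (fun i => dG i (s i)).
  by eexists; exact: (cderivM (cderiv_cst x _) Hd).
have [D' dE] : exists D',
    mxderiv x (fun t => \matrix_(i, j) ((\det (F t))^-1 * \adj (F t) i j)) D'.
  apply: dcol => i j.
  have [d1 H1] : cderivable x (fun t => (\det (F t))^-1).
    apply: cderivable_inv.
      by have /nbhs_singleton := Fu; rewrite unitmxE unitfE.
    by apply: ddet => k l; eexists; exact: dF.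
  have [d2 H2] : cderivable x (fun t => \adj (F t) i j).
    under eq_fun do rewrite mxE /cofactor.
    have [|d3 H3] := @ddet _ (fun t => row' j (col' i (F t))).
      by move=> k l; under eq_fun do rewrite !mxE; eexists; exact: dF.
    by eexists; exact: (cderivM (cderiv_cst x _) H3).
  by eexists; exact: cderivM H1 H2.
(* [invmx] is given by the cofactor formula on invertible matrices only, hence the restriction to a
   neighbourhood. *)
exists D'; apply: mxderiv_near_eq dE; apply: filterS Fu => t Fu.
by rewrite /invmx Fu; apply/matrixP => i j; rewrite !mxE.
Qed.

Lemma mxderiv_uniq m n (F : R -> 'M[R[i]]_(m, n)) D D' :
  mxderiv x F D -> mxderiv x F D' -> D = D'.
Proof.
move=> dF dG; apply/matrixP => i j.
have [[_ f1] [_ f2]] := dF i j; have [[_ g1] [_ g2]] := dG i j.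
by apply/eqP; rewrite eq_complex -f1 -f2 g1 g2 !eqxx.
Qed.

End Matrices.

(** Differentiability being known, F F^(-1) = 1 is differentiated and solved for the derivative of
    the inverse. *)
Lemma mxderiv_inv x n (F : R -> 'M[R[i]]_n) D :
  (\forall t \near x, F t \in unitmx) -> mxderiv x F D ->
  mxderiv x (fun t => invmx (F t)) (- (invmx (F x) *m D *m invmx (F x))).
Proof.
move=> Fu dF; have [D' dE] := mxderivable_inv Fu dF.
have Fux := nbhs_singleton Fu.
have : mxderiv x (fun=> 1%:M) (D *m invmx (F x) + F x *m D').
  apply: mxderiv_near_eq (mxderivM dF dE).
  by apply: filterS Fu => t Fu; rewrite mulmxV.
move=> /(mxderiv_uniq (mxderiv_cst x _)) /(congr1 (mulmx (invmx (F x)))).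
rewrite mulmx0 mulmxDr mulKmx// mulmxA => /esym/eqP;
  rewrite addrC addr_eq0 => /eqP <-.
exact: dE.
Qed.

End Derivatives.

(** * Entrywise limits *)

Section Limits.
Context {R : realType}.

Definition mxcvg m n (T : Type) (F : set_system T)
    (u : T -> 'M[R[i]]_(m, n)) (L : 'M[R[i]]_(m, n)) : Prop :=
  forall i j, complex.Re (u t i j) @[t --> F] --> complex.Re (L i j) /\
    complex.Im (u t i j) @[t --> F] --> complex.Im (L i j).

(** An l^1 norm with values in [R], whereas the modulus lies in [R[i]]; it is submultiplicative and
    free of square roots. *)
Definition norm1c (z : R[i]) : R := `|complex.Re z| + `|complex.Im z|.

Lemma le_normc_norm1c (z : R[i]) : `|z| <= (norm1c z)%:C.
Proof.
rewrite {1}(complexE z); apply: (le_trans (ler_normD _ _)).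
rewrite normrM !normc_def/= !expr0n/= !addr0 !add0r expr1n sqrtr1 mul1r
  !sqrtr_sqr.
by rewrite -rmorphD lexx.
Qed.

Lemma norm1c_ge0 z : 0 <= norm1c z. Proof. by rewrite addr_ge0. Qed.

Lemma norm1cD a b : norm1c (a + b) <= norm1c a + norm1c b.
Proof.
rewrite /norm1c cReD cImD addrACA lerD ?ler_normD//.
Qed.

Lemma norm1cM a b : norm1c (a * b) <= norm1c a * norm1c b.
Proof.
rewrite /norm1c cReM cImM mulrDl !mulrDr -!normrM.
rewrite (le_trans (lerD (ler_normB _ _) (ler_normD _ _)))//.
by rewrite le_eqVlt; apply/orP; left; apply/eqP; ring.
Qed.

Lemma norm1c_sum (I : Type) (r : seq I) (P : pred I) (f : I -> R[i]) :
  norm1c (\sum_(i <- r | P i) f i) <= \sum_(i <- r | P i) norm1c (f i).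
Proof.
elim/big_ind2 : _ => //; first by rewrite /norm1c !normr0 addr0.
by move=> a b c d ab cd; rewrite (le_trans (norm1cD _ _))// lerD.
Qed.

Lemma cvg_mxcvg m n T (F : set_system T) {FF : Filter F}
    (u : T -> 'M[R[i]]_(m, n)) L :
  mxcvg F u L -> u t @[t --> F] --> L.
Proof.
move=> uL; apply/cvg_ballP => e e0.
(* The radius of a ball is a positive element of [R[i]], hence real. *)
have [r r0 ->] : exists2 r : R, 0 < r & e = r%:C.
  exists (complex.Re e); first by move: e0; rewrite ltcE => /andP[_].
  by rewrite RRe_real// gtr0_real.
have : \forall t \near F, forall i j, norm1c (L i j - u t i j) < r.
  apply: filter_forall => i; apply: filter_forall => j.
  have [/cvgrPdist_lt/(_ _ (divr_gt0 r0 (ltr0n _ 2))) h1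
        /cvgrPdist_lt/(_ _ (divr_gt0 r0 (ltr0n _ 2))) h2] := uL i j.
  near=> t.
  rewrite [ltRHS]splitr /norm1c; apply: ltrD.
    have : `|complex.Re (L i j) - complex.Re (u t i j)| < r / 2 by near: t.
    by case: (L i j) (u t i j) => [? ?] [? ?].
  have : `|complex.Im (L i j) - complex.Im (u t i j)| < r / 2 by near: t.
  by case: (L i j) (u t i j) => [? ?] [? ?].
apply: filterS => t H; split; first by rewrite ltcR.
move=> i j; rewrite /ball/=.
by rewrite (le_lt_trans (le_normc_norm1c _))// ltcR.
Unshelve. all: by end_near. Qed.

Lemma mxcvg_uniq m n T (F : set_system T) {FF : ProperFilter F}
    (u : T -> 'M[R[i]]_(m, n)) L L' :
  mxcvg F u L -> mxcvg F u L' -> L = L'.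
Proof.
move=> H H'; apply/matrixP => i j; apply/eqP; rewrite eq_complex.
have [h1 h2] := H i j; have [h1' h2'] := H' i j.
by apply/andP; split; apply/eqP; [move: h1 h1'|move: h2 h2'];
  exact: (@cvg_unique _ (@Rhausdorff R)).
Qed.

Lemma mxcvgMl m n p T (F : set_system T) {FF : Filter F}
    (A : 'M[R[i]]_(p, m)) (u : T -> 'M[R[i]]_(m, n)) L :
  mxcvg F u L -> mxcvg F (fun t => A *m u t) (A *m L).
Proof.
move=> uL i j; split.
  rewrite mxE raddf_sum/=; under eq_fun do rewrite mxE raddf_sum/=.
  apply: (cvg_big (op := +%R) (P := xpredT)) => [|k _].
    exact: add_continuous.
  have [h1 h2] := uL k j.
  rewrite cReM; under eq_fun do rewrite cReM.
  by apply: cvgB; apply: cvgMr.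
rewrite mxE raddf_sum/=; under eq_fun do rewrite mxE raddf_sum/=.
apply: (cvg_big (op := +%R) (P := xpredT)) => [|k _].
  exact: add_continuous.
have [h1 h2] := uL k j.
rewrite cImM; under eq_fun do rewrite cImM.
by apply: cvgD; apply: cvgMr.
Qed.

Lemma mxcvg_adj m n T (F : set_system T) {FF : Filter F}
    (u : T -> 'M[R[i]]_(m, n)) L :
  mxcvg F u L -> mxcvg F (fun t => u t ^t*) (L ^t*).
Proof.
move=> uL i j; have [h1 h2] := uL j i; rewrite !mxE.
split; under eq_fun do rewrite !mxE.
  by rewrite cReJ; under eq_fun do rewrite cReJ.
by rewrite cImJ; under eq_fun do rewrite cImJ; exact: cvgN.
Qed.

(** Taking adjoints turns the right factor into a left one. *)
Lemma mxcvgMr m n p T (F : set_system T) {FF : Filter F}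
    (A : 'M[R[i]]_(n, p)) (u : T -> 'M[R[i]]_(m, n)) L :
  mxcvg F u L -> mxcvg F (fun t => u t *m A) (L *m A).
Proof.
move=> /mxcvg_adj/(mxcvgMl (A ^t*))/mxcvg_adj.
rewrite trmx_mul map_mxM !trmxCK.
by under eq_fun do rewrite trmx_mul map_mxM !trmxCK.
Qed.

End Limits.

(** * The matrix exponential *)

Section Exponential.
Context {R : realType}.

(* The scalar series whose sum is the value of [phi] at an entry of [C e^(xB)];
   the factor [C] makes the family closed under term by term differentiation. *)
Definition exp_entry_coef n (phi : R[i] -> R) (C B : 'M[R[i]]_n) i j
    (k : nat) : R :=
  k`!%:R^-1 * phi ((C *m B ^+ k) i j).

(** Since (k+1)/(k+1)! = 1/k!, formal differentiation only moves one factor [B] from the power into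
    [C]. *)
Lemma exp_entry_coef_diffs n phi (C B : 'M[R[i]]_n) i j :
  pseries_diffs (exp_entry_coef phi C B i j) =
  exp_entry_coef phi (C *m B) B i j.
Proof.
apply/funext => k; rewrite /pseries_diffs /exp_entry_coef mulrA; congr (_ * _).
  by rewrite factS natrM invfM mulrA mulfV ?mul1r.
by rewrite -mulmxA exprS.
Qed.

(** The sum of the entry norms is submultiplicative; the induction splits off the last factor
    [B]. *)
Lemma norm1c_mul_exp n (C B : 'M[R[i]]_n) i j k :
  norm1c ((C *m B ^+ k) i j) <=
    (\sum_i \sum_j norm1c (C i j)) * (\sum_i \sum_j norm1c (B i j)) ^+ k.
Proof.
have ge0 (A : 'M[R[i]]_n) : 0 <= \sum_i \sum_j norm1c (A i j).
  by apply: sumr_ge0 => ? _; apply: sumr_ge0 => ? _; exact: norm1c_ge0.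
elim: k i j => [|k IH] i j.
  rewrite mulr1 mulmx1 (bigD1 i)//= (bigD1 j)//= -addrA lerDl addr_ge0//.
    by apply: sumr_ge0 => ? _; exact: norm1c_ge0.
  by apply: sumr_ge0 => ? _; apply: sumr_ge0 => ? _; exact: norm1c_ge0.
rewrite exprSr -[B ^+ k * B]/(B ^+ k *m B) mulmxA mxE.
rewrite (le_trans (norm1c_sum _ _ _))// exprSr mulrA.
apply: (@le_trans _ _ (\sum_l ((\sum_i \sum_j norm1c (C i j)) *
    (\sum_i \sum_j norm1c (B i j)) ^+ k) * norm1c (B l j))).
  apply: ler_sum => l _; rewrite (le_trans (norm1cM _ _))//.
  by rewrite ler_wpM2r ?norm1c_ge0// IH.
rewrite -mulr_sumr ler_wpM2l//.
  by rewrite mulr_ge0// exprn_ge0.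
apply: ler_sum => l _; rewrite (bigD1 j)//= lerDl.
by apply: sumr_ge0 => ? _; exact: norm1c_ge0.
Qed.

(** Comparison with the scalar series of c e^(b|x|); the condition on [phi] covers real and
    imaginary parts alike. *)
Lemma is_cvg_exp_entry n phi (C B : 'M[R[i]]_n) i j x :
  (forall z, `|phi z| <= norm1c z) ->
  cvgn (pseries (exp_entry_coef phi C B i j) x).
Proof.
move=> phile; apply: normed_cvg.
set c := \sum_i \sum_j norm1c (C i j); set b := \sum_i \sum_j norm1c (B i j).
have b0 : 0 <= b.
  by apply: sumr_ge0 => ? _; apply: sumr_ge0 => ? _; exact: norm1c_ge0.
have c0 : 0 <= c.
  by apply: sumr_ge0 => ? _; apply: sumr_ge0 => ? _; exact: norm1c_ge0.
apply: (@series_le_cvg _ _ (fun k => c * exp_coeff (b * `|x|) k)).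
- by move=> k; rewrite normr_ge0.
- by move=> k; rewrite mulr_ge0// exp_coeff_ge0// mulr_ge0.
- move=> k; rewrite /exp_entry_coef /exp_coeff/= !normrM normfV normr_nat
    normrX exprMn.
  rewrite [_ / _]mulrC [leRHS]mulrCA -[leLHS]mulrA ler_wpM2l ?invr_ge0//.
  rewrite mulrA ler_wpM2r ?exprn_ge0//.
  by rewrite (le_trans (phile _))// norm1c_mul_exp.
- by apply: is_cvg_seriesZ; exact: is_cvg_series_exp_coeff.
Qed.

(** This is C e^(xB), as [mulexpE] confirms; real power series in each entry can be differentiated
    term by term. *)
Definition mulexp n (C B : 'M[R[i]]_n) (x : R) : 'M[R[i]]_n :=
  \matrix_(i, j)
    (limn (pseries (exp_entry_coef (@complex.Re R) C B i j) x) +i*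
     limn (pseries (exp_entry_coef (@complex.Im R) C B i j) x)).

Let Re_le (z : R[i]) : `|complex.Re z| <= norm1c z.
Proof. by rewrite lerDl. Qed.

Let Im_le (z : R[i]) : `|complex.Im z| <= norm1c z.
Proof. by rewrite lerDr. Qed.

Lemma mulexp_deriv n (C B : 'M[R[i]]_n) (x : R) :
  mxderiv x (mulexp C B) (mulexp (C *m B) B x).
Proof.
have H phi i j : (forall z : R[i], `|phi z| <= norm1c z) ->
    is_derive x (1 : R) (fun x => limn (pseries (exp_entry_coef phi C B i j) x))
     (limn (pseries (exp_entry_coef phi (C *m B) B i j) x)).
  move=> phile; rewrite -exp_entry_coef_diffs.
  (* Any radius beyond |x| would do; convergence there is checked for the series and its first two
     formal derivatives. *)
  apply: (@pseries_snd_diffs _ _ (`|x| + 1)).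
  - exact: is_cvg_exp_entry.
  - by rewrite exp_entry_coef_diffs; exact: is_cvg_exp_entry.
  - by rewrite !exp_entry_coef_diffs; exact: is_cvg_exp_entry.
  - by rewrite [ltRHS]ger0_norm// ltrDl.
move=> i j; split.
  under eq_fun do rewrite mxE/=; rewrite mxE/=; exact: H.
under eq_fun do rewrite mxE/=; rewrite mxE/=; exact: H.
Qed.

Lemma exprmxZ n (a : R[i]) (B : 'M[R[i]]_n) k :
  (a *: B) ^+ k = a ^+ k *: B ^+ k.
Proof.
elim: k => [|k IH]; first by rewrite !expr0 scale1r.
by rewrite !exprS IH -[LHS]scalemxAl -[X in _ *: X]scalemxAr scalerA.
Qed.

Lemma mulexp_cvg n (C B : 'M[R[i]]_n) (x : R) :
  mxcvg \oo
    (fun N => C *m series (fun k => k`!%:R^-1 *: (x%:C *: B) ^+ k) N)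
    (mulexp C B x).
Proof.
have E (phi : {additive R[i] -> R}) i j N :
   (forall a z, phi (a%:C * z) = a * phi z) ->
   phi ((C *m series (fun k => k`!%:R^-1 *: (x%:C *: B) ^+ k) N) i j) =
   pseries (exp_entry_coef phi C B i j) x N.
  move=> phiZ; rewrite /pseries /series/= mulmx_sumr summxE raddf_sum.
  apply: eq_bigr => k _; rewrite exprmxZ -!scalemxAr !mxE.
  (* The coefficient 1/k! of [R[i]] is the image of a real number, so it can be pulled out of
     [phi]. *)
  rewrite -[k`!%:R^-1](_ : (k`!%:R^-1)%:C = _);
    last by rewrite fmorphV rmorph_nat.
  by rewrite -rmorphXn/= !phiZ /exp_entry_coef mxE [x ^+ k * _]mulrC mulrA.
move=> i j; rewrite !mxE/=; split.
  under eq_fun do rewrite (E _ _ _ _ complex_ReZ); exact: is_cvg_exp_entry.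
under eq_fun do rewrite (E _ _ _ _ complex_ImZ); exact: is_cvg_exp_entry.
Qed.

Lemma expmxZ n (B : 'M[R[i]]_n) (x : R) : expmx (x%:C *: B) = mulexp 1%:M B x.
Proof.
have /cvg_mxcvg := @mulexp_cvg n 1%:M B x.
under eq_fun do rewrite mul1mx.
by move=> /cvg_lim; apply.
Qed.

Lemma expmx_cvg n (A : 'M[R[i]]_n) :
  mxcvg \oo (series (fun k => k`!%:R^-1 *: A ^+ k)) (expmx A).
Proof.
have := @mulexp_cvg n 1%:M A 1; rewrite -expmxZ scale1r.
by under eq_fun do rewrite mul1mx.
Qed.

(** Both sides are limits of the same sequence of matrices. *)
Lemma mulexpE n (C B : 'M[R[i]]_n) (x : R) :
  mulexp C B x = C *m expmx (x%:C *: B).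
Proof. exact: (mxcvg_uniq (@mulexp_cvg n C B x) (mxcvgMl C (expmx_cvg _))). Qed.

Lemma expmx_deriv n (B : 'M[R[i]]_n) (x : R) :
  mxderiv x (fun t => expmx (t%:C *: B)) (B *m expmx (x%:C *: B)).
Proof.
under eq_fun do rewrite expmxZ.
by rewrite -mulexpE; have := mulexp_deriv 1%:M B x; rewrite mul1mx.
Qed.

Lemma expmx0 n : expmx (0 : 'M[R[i]]_n) = 1%:M.
Proof.
apply: (mxcvg_uniq (expmx_cvg _)) => i j.
(* The partial sum of index 0 is empty, so the sequence is constant only from index 1 on. *)
suff E N : series (fun k => k`!%:R^-1 *: (0 : 'M[R[i]]_n) ^+ k) N.+1 = 1%:M.
  by split; rewrite -cvg_shiftS; under eq_fun do rewrite E; exact: cvg_cst.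
rewrite /series/= big_nat_recl//= invr1 scale1r big1 ?addr0// => k _.
by rewrite expr0n/= scaler0.
Qed.

Lemma expmx_adj n (A : 'M[R[i]]_n) : (expmx A) ^t* = expmx (A ^t*).
Proof.
apply: mxcvg_uniq (expmx_cvg (A ^t*)).
suff <- : (fun N => series (fun k => k`!%:R^-1 *: A ^+ k) N ^t*) =
   series (fun k => k`!%:R^-1 *: A ^t* ^+ k) by exact/mxcvg_adj/expmx_cvg.
apply/funext => N; rewrite /series/= !raddf_sum/=.
apply: eq_bigr => k _; rewrite linearZ/= map_mxZ fmorphV rmorph_nat;
  congr (_ *: _).
elim: k => [|k IH]; first by rewrite !expr0 trmx1 map_mx1.
by rewrite exprS exprSr -IH -[RHS]/(_ *m _) -map_mxM -trmx_mul.
Qed.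

End Exponential.

(** * Real analysis *)

Section RealAnalysis.
Context {R : realType}.
Implicit Types (f g h : R -> R) (a s t x : R).

Lemma is_derive_continuous f x d : is_derive x (1 : R) f d ->
  {for x, continuous f}.
Proof. by move=> [df _]; exact/differentiable_continuous/derivable1_diffP. Qed.

(** The closed range of [c] makes the degenerate case s = t admissible. *)
Lemma MVT_ray f g a s t : (forall x, a < x -> is_derive x (1 : R) f (g x)) ->
  a < s -> s <= t -> exists2 c, s <= c <= t & f t - f s = g c * (t - s).
Proof.
move=> fg s_gt st.
have [||c cst E] := @MVT_segment _ f g s t st.
- by move=> c; rewrite in_itv/= => /andP[sc _]; exact/fg/(lt_trans s_gt).
- apply: continuous_in_subspaceT => c; rewrite inE/= in_itv/= => /andP[sc _].
  by apply: is_derive_continuous; exact/fg/(lt_le_trans s_gt).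
- by exists c => //; move: cst; rewrite in_itv.
Qed.

(* The base point is moved to -1 to make [G] differentiable at 0. *)
Lemma integral_antiderivative f : continuous f -> exists G,
  [/\ forall x, -1 < x -> is_derive x (1 : R) G (f x), G 0 = 0 &
      forall x, 0 <= x -> \int[lebesgue_measure]_(t in `[0, x]) f t = G x].
Proof.
move=> fc.
have fi a b : lebesgue_measure.-integrable `[a, b] (EFin \o f).
  apply: continuous_compact_integrable; first exact: segment_compact.
  by apply: continuous_subspaceT.
exists (fun x => \int[lebesgue_measure]_(t in `[-1, x]) f t -
  \int[lebesgue_measure]_(t in `[-1, 0]) f t); split.
- move=> x x1.
  have xx1 : x < x + 1 by rewrite ltrDl.
  have [d1 d2] := @continuous_FTC1_closed R f (-1) x (x + 1) xx1 (fi _ _) x1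
    (fc x).
  rewrite -[f x]subr0; apply: is_deriveB.
  by apply: (DeriveDef d1); rewrite -derive1E.
- by rewrite subrr.
(* The difference is the integral over ]0, x], and the endpoint 0 has measure zero. *)
- move=> x x0; rewrite Rintegral_itvB//= ?bnd_simp//.
  rewrite Rintegral_itv_obnd_cbnd//.
  by apply: integrableS (fi 0 x) => //; apply: subset_itvr; rewrite bnd_simp.
Qed.

(* Barbalat's lemma: [f' <= K] and [f x <= - e] keep [f] below [- e / 2] on a
   further interval of length [e / (2 K)], where [g] loses [e ^+ 2 / (4 K)]. *)
Lemma cvg_derive_nonincreasing g f h (K : R) :
  (forall x, 0 < x -> is_derive x (1 : R) g (f x)) ->
  (forall x, 0 < x -> is_derive x (1 : R) f (h x)) ->
  (forall x, 0 < x -> 0 <= g x) -> (forall x, 0 < x -> f x <= 0) ->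
  (forall x, 0 < x -> h x <= K) ->
  f x @[x --> +oo] --> 0.
Proof.
move=> dg df g0 f0 hK.
(* [K'] is an upper bound that is also strictly positive, as needed for a divisor. *)
pose K' := `|K| + 1.
have K'0 : 0 < K' by rewrite ltr_wpDl.
have hK' x : 0 < x -> h x <= K'.
  by move=> /hK/le_trans; apply; apply: (le_trans (ler_norm _)); rewrite lerDl.
have gdec s t : 0 < s -> s <= t -> g t <= g s.
  move=> s0 st; have [c /andP[sc _] E] := MVT_ray dg s0 st.
  by rewrite -subr_le0 E mulr_le0_ge0// ?subr_ge0// f0// (lt_le_trans s0).
pose S := [set g x | x in [set x | 0 < x]].
have Sinf : has_inf S.
  split; first by exists (g 1); exists 1 => /=.
  by exists 0 => _ [x /= x0 <-]; exact: g0.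
apply/cvgrPdist_lt => e e0.
have d0 : 0 < e ^+ 2 / (4 * K') by rewrite divr_gt0 ?exprn_gt0// mulr_gt0.
(* From [X] on, [g] is so close to its infimum that it can no longer lose e^2 / (4 K'). *)
have [_ [X /= X0 <-] gX] := inf_adherent d0 Sinf.
near=> x.
have Xx : X <= x by near: x; apply: nbhs_pinfty_ge; rewrite num_real.
have x0 : 0 < x by exact: lt_le_trans Xx.
rewrite sub0r normrN ler0_norm ?f0// ltNge; apply/negP => ef.
pose s := e / (2 * K').
have s0 : 0 < s by rewrite divr_gt0// mulr_gt0.
have xs : x <= x + s by rewrite lerDl ltW.
have [c /andP[xc cs] E] := MVT_ray dg x0 xs.
have [c' /andP[xc' _] E'] := MVT_ray df x0 xc.
(* Since c - x <= s, the rise of [f] from a value at most -e is at most K' s = e / 2. *)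
have fc : f c <= - (e / 2).
  have : f c - f x <= e / 2.
    rewrite E' (_ : e / 2 = K' * s); last by rewrite /s; field; rewrite gt_eqF.
    apply: (@le_trans _ _ (K' * (c - x))).
      by rewrite ler_wpM2r ?subr_ge0// hK'// (lt_le_trans x0).
    by rewrite ler_wpM2l ?lerBlDl// ltW.
  by lra.
have gl : inf S <= g (x + s).
  by apply: ge_inf; [case: Sinf|exists (x + s) => //=; rewrite addr_gt0].
have gx : g x <= g X by exact: gdec.
have : g (x + s) - g x <= - (e ^+ 2 / (4 * K')).
  rewrite E addrAC subrr add0r (_ : e ^+ 2 / (4 * K') = e / 2 * s).
    by rewrite -mulNr ler_wpM2r// ltW.
  by rewrite /s; field; rewrite gt_eqF.
move: gX gl gx; set d := e ^+ 2 / _; lra.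
Unshelve. all: by end_near. Qed.

End RealAnalysis.

(** * Adjoints, positivity and bounds *)

Section MatrixAnalysis.
Context {R : realType}.
Implicit Types x : R.

Lemma conj_complexi : Num.conj ('i%C : R[i]) = - 'i%C.
Proof. by apply/eqP; rewrite eq_complex/= oppr0 !eqxx. Qed.

Lemma adjM m n p (A : 'M[R[i]]_(m, n)) (B : 'M[R[i]]_(n, p)) :
  (A *m B) ^t* = B ^t* *m A ^t*.
Proof. by rewrite trmx_mul map_mxM. Qed.

Lemma adjD m n (A B : 'M[R[i]]_(m, n)) : (A + B) ^t* = A ^t* + B ^t*.
Proof. by rewrite linearD/= map_mxD. Qed.

Lemma adjN m n (A : 'M[R[i]]_(m, n)) : (- A) ^t* = - A ^t*.
Proof. by rewrite linearN/= map_mxN. Qed.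

Lemma adjZ m n (a : R[i]) (A : 'M[R[i]]_(m, n)) :
  (a *: A) ^t* = Num.conj a *: A ^t*.
Proof. by rewrite linearZ/= map_mxZ. Qed.

Lemma adj_inv n (A : 'M[R[i]]_n) : (invmx A) ^t* = invmx (A ^t*).
Proof. by rewrite trmx_inv map_invmx. Qed.

(** The mean value theorem is used on either side of 0; the ray starts at -1 to make 0, where
    initial values are known, an interior point. *)
Lemma mxderiv0_cst m n (F : R -> 'M[R[i]]_(m, n)) :
  (forall x, -1 < x -> mxderiv x F 0) -> forall x, -1 < x -> F x = F 0.
Proof.
move=> dF.
have cst (f : R -> R) : (forall x, -1 < x -> is_derive x (1 : R) f 0) ->
    forall x, -1 < x -> f x = f 0.
  move=> df x x1; have N10 : -1 < (0 : R) by rewrite ltrN10.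
  apply/eqP; rewrite -subr_eq0.
  have [x0|/ltW x0] := leP 0 x.
    by have [c _ ->] := MVT_ray (g := fun=> 0) df N10 x0; rewrite mul0r.
  by rewrite -oppr_eq0 opprB;
    have [c _ ->] := MVT_ray (g := fun=> 0) df x1 x0; rewrite mul0r.
move=> x x1; apply/matrixP => i j; apply/eqP; rewrite eq_complex.
apply/andP; split; apply/eqP.
  apply: (cst (fun t => complex.Re (F t i j))) => // y y1.
  by have [] := dF y y1 i j; rewrite mxE.
apply: (cst (fun t => complex.Im (F t i j))) => // y y1.
by have [] := dF y y1 i j; rewrite mxE.
Qed.

(** [A] commutes with every partial sum of the series. *)
Lemma expmx_comm n (A B : 'M[R[i]]_n) : A *m B = B *m A ->
  A *m expmx B = expmx B *m A.
Proof.
move=> AB; apply: mxcvg_uniq (mxcvgMl A (expmx_cvg B)) _.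
suff -> : (fun N => A *m series (fun k => k`!%:R^-1 *: B ^+ k) N) =
   (fun N => series (fun k => k`!%:R^-1 *: B ^+ k) N *m A).
  exact/mxcvgMr/expmx_cvg.
apply/funext => N; rewrite /series/= mulmx_sumr mulmx_suml;
  apply: eq_bigr => k _.
rewrite -scalemxAr -scalemxAl; congr (_ *: _).
by apply: commrX.
Qed.

(** The product has derivative zero and equals 1 at 0. *)
Lemma expmxNK n (B : 'M[R[i]]_n) (x : R) :
  expmx (x%:C *: (- B)) *m expmx (x%:C *: B) = 1%:M.
Proof.
have N1 (t : R) : -1 < t ->
    mxderiv t (fun t => expmx (t%:C *: (- B)) *m expmx (t%:C *: B)) 0.
  move=> _; apply: mxderiv_eq (mxderivM (expmx_deriv _ _)
    (expmx_deriv _ _)) => //.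
  rewrite (expmx_comm (A := - B)); last by rewrite -scalemxAr -scalemxAl.
  by rewrite -!mulmxA mulNmx mulmxN addNr.
have main y : 0 <= y -> expmx (y%:C *: (- B)) *m expmx (y%:C *: B) = 1%:M.
  move=> y0; rewrite (mxderiv0_cst N1) ?(lt_le_trans _ y0) ?ltrN10//.
  by rewrite !scale0r !expmx0 mulmx1.
(* Constancy is available only to the right of -1, so a negative [x] is handled at [- x] with the
   two factors exchanged. *)
have [x0|/ltW x0] := leP 0 x; first exact: main.
have := main (- x); rewrite oppr_ge0 => /(_ x0).
by rewrite rmorphN/= !scaleNr !scalerN opprK => /mulmx1C.
Qed.

(** Differentiability of [F] supplies the continuity of the entries. [G] continues the integral to
    the left of 0, which gives a two-sided derivative at 0. *)
Lemma integralmx_antiderivative m n (F : R -> 'M[R[i]]_(m, n)) :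
  (forall x, exists D, mxderiv x F D) -> exists G,
  [/\ forall x, -1 < x -> mxderiv x G (F x), G 0 = 0 &
      forall x, 0 <= x -> integralmx 0 x F = G x].
Proof.
move=> dF.
have cRe i j : continuous (fun t => complex.Re (F t i j)).
  by move=> t; have [D /(_ i j)[? _]] := dF t; exact: is_derive_continuous.
have cIm i j : continuous (fun t => complex.Im (F t i j)).
  by move=> t; have [D /(_ i j)[_ ?]] := dF t; exact: is_derive_continuous.
pose g i j := sval (cid (integral_antiderivative (cRe i j))).
pose h i j := sval (cid (integral_antiderivative (cIm i j))).
have gP i j := svalP (cid (integral_antiderivative (cRe i j))).
have hP i j := svalP (cid (integral_antiderivative (cIm i j))).
exists (fun x => \matrix_(i, j) (g i j x +i* h i j x)); split.
- move=> x x1 i j; split; under eq_fun do rewrite mxE/=.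
    by have [+ _ _] := gP i j; exact.
  by have [+ _ _] := hP i j; exact.
- apply/matrixP => i j; rewrite !mxE; apply/eqP; rewrite eq_complex/=.
  have [_ g0 _] := gP i j; have [_ h0 _] := hP i j.
  by rewrite /g /h g0 h0 !eqxx.
- move=> x x0; apply/matrixP => i j; rewrite !mxE.
  have [_ _ gx] := gP i j; have [_ _ hx] := hP i j.
  by rewrite /g /h gx// hx.
Qed.

Definition sqnormc (z : R[i]) : R := complex.Re z ^+ 2 + complex.Im z ^+ 2.

Lemma sqnormc_ge0 z : 0 <= sqnormc z.
Proof. by rewrite addr_ge0// sqr_ge0. Qed.

Lemma Re_mulmx_adj m n (Y : 'M[R[i]]_(m, n)) k :
  complex.Re ((Y *m Y ^t*) k k) = \sum_l sqnormc (Y k l).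
Proof.
rewrite mxE raddf_sum; apply: eq_bigr => l _.
by rewrite !mxE /sqnormc; case: (Y k l) => a b /=; rewrite mulrN opprK -!expr2.
Qed.

(** Diagonalising A = P^H D P with [P] unitary turns the form on row k of [Y] into the sum of d_l
    |(Y P^H)_kl|^2. *)
Lemma posdefmx_bound n (A : 'M[R[i]]_n) : posdefmx A ->
  exists2 lambda : R, 0 < lambda & forall m (Y : 'M[R[i]]_(m, n)) k,
    lambda * \sum_l sqnormc (Y k l) <= complex.Re ((Y *m A *m Y ^t*) k k).
Proof.
move=> [Aherm Apos].
set P := spectralmx A; set d := spectral_diag A.
have AE : A = invmx P *m diag_mx d *m P.
  by apply/orthomx_spectralP; exact: hermitian_normalmx.
have Pu : P \is unitarymx := spectral_unitarymx A.
have PV : invmx P = P ^t* := invmx_unitary Pu.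
(* Row l of [P] is a left eigenvector for d_l, nonzero because the rows of [P] are orthonormal. *)
have d_gt0 l : 0 < d 0 l.
  apply: Apos; apply/eigenvalueP; exists (row l P).
    rewrite {1}AE -row_mul !mulmxA mulmxV ?unitarymx_unit// mul1mx.
    by rewrite mul_diag_mx; apply/rowP => j; rewrite !mxE.
  apply/negP => /eqP rP0; have /unitarymxP/(congr1 (row l)) := Pu.
  rewrite row_mul rP0 mul0mx => /rowP/(_ l); rewrite !mxE eqxx => /eqP.
  by rewrite eq_sym oner_eq0.
(* The smallest eigenvalue, capped at 1 so that the minimum stays positive when n = 0. *)
exists (\big[Num.min/1]_l complex.Re (d 0 l)).
  apply: lt_bigmin => // l _; by have := d_gt0 l; rewrite ltcE => /andP[].
move=> m Y k; set lambda := \big[_/_]_l _.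
have -> : Y *m A *m Y ^t* = (Y *m P ^t*) *m diag_mx d *m (Y *m P ^t*) ^t*.
  by rewrite {1}AE PV adjM trmxCK !mulmxA.
(* A unitary factor preserves the norm of each row. *)
have -> : \sum_l sqnormc (Y k l) = \sum_l sqnormc ((Y *m P ^t*) k l).
  rewrite -!Re_mulmx_adj adjM trmxCK -!mulmxA (mulmxA (P ^t*)).
  by rewrite -PV mulVmx ?unitarymx_unit// mul1mx.
set Z := Y *m P ^t*; rewrite mulr_sumr mxE raddf_sum/=; apply: ler_sum => l _.
have -> : complex.Re ((Z *m diag_mx d) k l * (Z ^t*) l k) =
    complex.Re (d 0 l) * sqnormc (Z k l).
  move: (Z) => Z'; rewrite mul_mx_diag !mxE /sqnormc.
  have : complex.Im (d 0 l) = 0 by apply: ger0_Im; exact: ltW.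
  by case: (Z' k l) (d 0 l) => a b [u v] /= ->; ring.
rewrite ler_wpM2r ?sqnormc_ge0//; exact: bigmin_le.
Qed.

Lemma posdefmx_adj n (A : 'M[R[i]]_n) : posdefmx A -> A ^t* = A.
Proof. by move=> [/is_hermitianmxP + _]; rewrite expr0 scale1r => <-. Qed.

(** * Matrix functions bounded on the positive half-line *)

Definition mxbounded m n (F : R -> 'M[R[i]]_(m, n)) :=
  exists K, forall x, 0 < x -> forall i j, norm1c (F x i j) <= K.

Lemma mxbounded_cst m n (A : 'M[R[i]]_(m, n)) : mxbounded (fun=> A).
Proof.
exists (\sum_i \sum_j norm1c (A i j)) => _ _ i j.
rewrite (bigD1 i)//= (bigD1 j)//= -addrA lerDl addr_ge0//.
  by apply: sumr_ge0 => ? _; exact: norm1c_ge0.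
by apply: sumr_ge0 => ? _; apply: sumr_ge0 => ? _; exact: norm1c_ge0.
Qed.

Lemma mxboundedD m n (F G : R -> 'M[R[i]]_(m, n)) :
  mxbounded F -> mxbounded G -> mxbounded (fun x => F x + G x).
Proof.
move=> [K FK] [L GL]; exists (K + L) => x x0 i j.
by rewrite mxE (le_trans (norm1cD _ _))// lerD ?FK ?GL.
Qed.

Lemma mxboundedM m n p (F : R -> 'M[R[i]]_(m, n)) (G : R -> 'M[R[i]]_(n, p)) :
  mxbounded F -> mxbounded G -> mxbounded (fun x => F x *m G x).
Proof.
move=> [K FK] [L GL]; exists (\sum_(i < n) K * L) => x x0 i j.
rewrite mxE (le_trans (norm1c_sum _ _ _))// ler_sum// => k _.
by rewrite (le_trans (norm1cM _ _))// ler_pM ?norm1c_ge0 ?FK ?GL.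
Qed.

Lemma mxboundedZ m n a (F : R -> 'M[R[i]]_(m, n)) :
  mxbounded F -> mxbounded (fun x => a *: F x).
Proof.
move=> /(mxboundedM (mxbounded_cst a%:M)).
by under eq_fun do rewrite mul_scalar_mx.
Qed.

Lemma mxbounded_adj m n (F : R -> 'M[R[i]]_(m, n)) :
  mxbounded F -> mxbounded (fun x => F x ^t*).
Proof.
move=> [K FK]; exists K => x x0 i j.
by rewrite !mxE /norm1c cReJ cImJ normrN; exact: FK.
Qed.

(** From (|a| - 1/2)^2 >= 0, applied to each of the two parts. *)
Lemma norm1c_le_sqnormc z : norm1c z <= sqnormc z + 1.
Proof.
have le (a : R) : `|a| <= a ^+ 2 + 1 / 2.
  rewrite -real_normK ?num_real//; have := sqr_ge0 (`|a| - 1 / 2); nra.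
by have := le (complex.Re z); have := le (complex.Im z);
  rewrite /norm1c /sqnormc; lra.
Qed.

End MatrixAnalysis.

(** * The conjugated Gramian *)

Section Potential.
Context {R : realType}.
Implicit Types x t : R.

Lemma mul_complexi (V : lmodType R[i]) (A : V) : 'i%C *: ('i%C *: A) = - A.
Proof. by rewrite scalerA -expr2 sqr_i scaleN1r. Qed.

Lemma conj_complexNi : Num.conj (- 'i%C : R[i]) = 'i%C.
Proof. by apply/eqP; rewrite eq_complex/= !oppr0 opprK !eqxx. Qed.

Lemma conj_complexNiM x : Num.conj (- ('i%C * x%:C) : R[i]) = 'i%C * x%:C.
Proof.
by apply/eqP; rewrite eq_complex/=
  !(mul0r, mul1r, mulr0, oppr0, opprK, subr0, addr0, add0r) !eqxx.
Qed.

Lemma signmx_sandwich n m1 m2 (A : 'M[R[i]]_(n, m1)) (B : 'M[R[i]]_(n, m2)) :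
  row_mx A B *m signmx m1 m2 *m (row_mx A B) ^t* = A *m A ^t* - B *m B ^t*.
Proof.
rewrite /signmx mul_row_block !mulmx0 mulmx1 addr0 add0r mulmxN mulmx1.
by rewrite tr_row_mx map_col_mx mul_row_col mulNmx.
Qed.

(** Serves with c = -i for the first block of [Lambda] and with c = i for the second. *)
Lemma mxderiv_gram n m (alpha : 'M[R[i]]_n) (c : R[i])
    (A : R -> 'M[R[i]]_(n, m)) x :
  mxderiv x A (c *: (alpha *m A x)) ->
  mxderiv x (fun t => A t *m (A t) ^t*)
    (c *: (alpha *m (A x *m (A x) ^t*)) +
     Num.conj c *: (A x *m (A x) ^t* *m alpha ^t*)).
Proof.
move=> dA; apply: mxderiv_eq (mxderivM dA (mxderiv_adj dA)) => //.
by rewrite adjZ adjM -scalemxAl -scalemxAr !mulmxA.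
Qed.

Section Gramian.
Variables (n m1 m2 : nat) (alpha S0 : 'M[R[i]]_n).
Variables (theta1 : 'M[R[i]]_(n, m1)) (theta2 : 'M[R[i]]_(n, m2)).
Hypothesis adm : admissible alpha S0 theta1 theta2.

(* [E], [Ei], [A] and [B] are variables rather than definitions: unification
   would otherwise unfold them down to [expmx]. *)
Variables (E Ei : R -> 'M[R[i]]_n).
Hypothesis EE : forall x, E x = expmx (('i%C * x%:C) *: alpha).
Hypothesis EiE : forall x, Ei x = expmx ((- ('i%C * x%:C)) *: alpha).

Let dE x : mxderiv x E ('i%C *: (alpha *m E x)).
Proof.
have e t : expmx (t%:C *: ('i%C *: alpha)) = E t by rewrite EE scalerA mulrC.
by rewrite scalemxAl; apply: mxderiv_eq (expmx_deriv ('i%C *: alpha) x);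
  rewrite ?e.
Qed.

Let EiE' x : Ei x = expmx (x%:C *: - ('i%C *: alpha)).
Proof. by rewrite EiE scalerN scalerA scaleNr mulrC. Qed.

Let dEi x : mxderiv x Ei (- 'i%C *: (alpha *m Ei x)).
Proof.
rewrite scaleNr scalemxAl -mulNmx.
by apply: mxderiv_eq (expmx_deriv (- ('i%C *: alpha)) x) => [t|]; rewrite EiE'.
Qed.

Let EiK x : Ei x *m E x = 1%:M.
Proof. by rewrite EiE' EE mulrC -scalerA; exact: expmxNK. Qed.

Let EK x : E x *m Ei x = 1%:M. Proof. exact/mulmx1C/EiK. Qed.

Let Ei_comm x : alpha *m Ei x = Ei x *m alpha.
Proof. by rewrite EiE; apply: expmx_comm; rewrite -scalemxAr -scalemxAl. Qed.

Let E0 : E 0 = 1%:M. Proof. by rewrite EE mulr0 scale0r expmx0. Qed.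

Let Ei0 : Ei 0 = 1%:M. Proof. by rewrite EiE mulr0 oppr0 scale0r expmx0. Qed.

Variables (A : R -> 'M[R[i]]_(n, m1)) (B : R -> 'M[R[i]]_(n, m2)).
Hypothesis AE : forall x, A x = Ei x *m theta1.
Hypothesis BE : forall x, B x = E x *m theta2.

Let dA x : mxderiv x A (- 'i%C *: (alpha *m A x)).
Proof.
rewrite AE mulmxA scalemxAl.
by apply: mxderiv_eq (mxderivMr theta1 (dEi x)) => // t; rewrite AE.
Qed.

Let dB x : mxderiv x B ('i%C *: (alpha *m B x)).
Proof.
rewrite BE mulmxA scalemxAl.
by apply: mxderiv_eq (mxderivMr theta2 (dE x)) => // t; rewrite BE.
Qed.

(** For negative x the integral over [[0, x]] is empty; replacing it by an antiderivative gives an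
    extension of S(x) that is differentiable at 0. *)
Let Smx_extension : exists S,
  [/\ forall x, -1 < x -> mxderiv x S (A x *m (A x) ^t* - B x *m (B x) ^t*),
      S 0 = S0 & forall x, 0 <= x -> Smx alpha S0 theta1 theta2 x = S x].
Proof.
have LE x : Lambda alpha theta1 theta2 x = row_mx (A x) (B x).
  by rewrite AE BE EE EiE.
have [|G [dG G0 GE]] := @integralmx_antiderivative R n n
    (fun t => Lambda alpha theta1 theta2 t *m signmx m1 m2 *m
      (Lambda alpha theta1 theta2 t) ^t*).
  move=> x; eexists.
  apply: mxderiv_eq (mxderivB (mxderiv_gram (dA x))
    (mxderiv_gram (dB x))) => // t.
  by rewrite LE signmx_sandwich.
exists (fun x => S0 + G x); split.
- move=> x x1; rewrite -[X in mxderiv _ _ X]add0r; apply: mxderivD;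
    first exact: mxderiv_cst.
  by rewrite -signmx_sandwich -LE; exact: dG.
- by rewrite G0 addr0.
- by move=> x x0; rewrite /Smx GE.
Qed.

(** Both identities hold at 0 by admissibility, and the difference of their sides has derivative
    zero. *)
Let Smx_identities S :
  (forall x, -1 < x -> mxderiv x S (A x *m (A x) ^t* - B x *m (B x) ^t*)) ->
  S 0 = S0 -> forall x, -1 < x ->
    (S x) ^t* = S x /\ alpha *m S x - S x *m alpha ^t* =
    'i%C *: (A x *m (A x) ^t* + B x *m (B x) ^t*).
Proof.
move=> dS S0E x x1; have [S0pos S0id] := adm; split.
  apply/eqP; rewrite -subr_eq0; apply/eqP.
  rewrite (mxderiv0_cst (F := fun t => (S t) ^t* - S t))
    ?S0E ?posdefmx_adj ?subrr//.
  move=> t t1; apply: mxderiv_eq (mxderivB (mxderiv_adj (dS t t1))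
    (dS t t1)) => //.
  by rewrite adjD adjN !adjM !trmxCK subrr.
apply/eqP; rewrite -subr_eq0; apply/eqP.
(* [N] is the defect of the identity. Its derivative vanishes because (A A^H)' = -i (alpha A A^H - A
   A^H alpha^H), with i in place of -i for [B]. *)
pose N t := alpha *m S t - S t *m alpha ^t* -
  'i%C *: (A t *m (A t) ^t* + B t *m (B t) ^t*).
rewrite -[LHS]/(N x) (mxderiv0_cst (F := N)) ?/N ?S0E ?S0id//.
  by rewrite AE BE E0 Ei0 !mul1mx subrr.
move=> t t1; apply: mxderiv_eq (mxderivB (mxderivB (mxderivMl alpha (dS t t1))
  (mxderivMr (alpha ^t*) (dS t t1)))
    (mxderivZ 'i%C (mxderivD (mxderiv_gram (dA t))
      (mxderiv_gram (dB t))))) => //.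
rewrite conj_complexNi conj_complexi mulmxBr mulmxBl.
move: (alpha *m _) (_ *m alpha ^t*) (alpha *m _) (_ *m alpha ^t*) =>
  X1 X2 X3 X4.
by apply/matrixP => i j; rewrite !mxE; ring: (sqr_i R).
Qed.

(** The witnesses are w = Ei A = e^(-2ix alpha) theta_1 and Q = Ei S Ei^H; the decay argument uses
    only the properties listed here. *)
Lemma gramian_exists :
  exists (w : R -> 'M[R[i]]_(n, m1)) (Q : R -> 'M[R[i]]_n),
  [/\ Q 0 = S0,
     forall x, mxderiv x w (- (2 * 'i%C) *: (alpha *m w x)),
     forall x, -1 < x -> [/\ mxderiv x Q (2 *: (w x *m (w x) ^t*)),
        (Q x) ^t* = Q x &
        alpha *m Q x - Q x *m alpha ^t* =
          'i%C *: (w x *m (w x) ^t* + theta2 *m theta2 ^t*)] &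
     forall x, 0 <= x -> Q x \in unitmx ->
       potential alpha S0 theta1 theta2 x =
         2 *: ((w x) ^t* *m invmx (Q x) *m theta2)].
Proof.
have [S [dS S0E SE]] := Smx_extension.
have {}Sprop := Smx_identities dS S0E.
have Ealpha x : (Ei x) ^t* *m alpha ^t* = alpha ^t* *m (Ei x) ^t*.
  by rewrite -!adjM Ei_comm.
have EKadj x : (Ei x) ^t* *m (E x) ^t* = 1%:M by rewrite -adjM EK trmx1 map_mx1.
have EiKadj x : (E x) ^t* *m (Ei x) ^t* = 1%:M.
  by rewrite -adjM EiK trmx1 map_mx1.
(* Conjugation makes the second block constant, as Ei B = theta_2. *)
have BB x : Ei x *m (B x *m (B x) ^t*) *m (Ei x) ^t* = theta2 *m theta2 ^t*.
  by rewrite BE adjM !mulmxA EiK mul1mx -!mulmxA EiKadj mulmx1.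
have AA x : Ei x *m (A x *m (A x) ^t*) *m (Ei x) ^t* =
    Ei x *m A x *m (Ei x *m A x) ^t*.
  by rewrite adjM !mulmxA.
(* [Ei] commutes with [alpha], so the identity for [S] can be conjugated as a whole. *)
have Qid x : -1 < x ->
    alpha *m (Ei x *m S x *m (Ei x) ^t*) -
      Ei x *m S x *m (Ei x) ^t* *m alpha ^t* =
    'i%C *: (Ei x *m A x *m (Ei x *m A x) ^t* + theta2 *m theta2 ^t*).
  move=> x1; have [_ Sid] := Sprop x x1.
  rewrite !mulmxA Ei_comm -(mulmxA _ _ (alpha ^t*)) Ealpha !mulmxA -mulmxBl.
  rewrite -!(mulmxA (Ei x)) -mulmxBr Sid -scalemxAr -scalemxAl mulmxDr mulmxDl.
  by rewrite AA BB -mulmxA.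
exists (fun x => Ei x *m A x), (fun x => Ei x *m S x *m (Ei x) ^t*); split.
- by rewrite Ei0 S0E trmx1 map_mx1 mulmx1 mul1mx.
- move=> x; apply: mxderiv_eq (mxderivM (dEi x) (dA x)) => //.
  rewrite -scalemxAl -scalemxAr (mulmxA (Ei x)) -Ei_comm -!mulmxA -scalerDl.
  by rewrite -opprD mulrDl mul1r.
- move=> x x1; split; last exact: Qid.
    have h1 : - 'i%C *: (alpha *m Ei x) *m S x *m (Ei x) ^t* =
        - 'i%C *: (alpha *m (Ei x *m S x *m (Ei x) ^t*)).
      by rewrite -!scalemxAl !mulmxA.
    have h2 : Ei x *m S x *m (- 'i%C *: (alpha *m Ei x)) ^t* =
        'i%C *: (Ei x *m S x *m (Ei x) ^t* *m alpha ^t*).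
      by rewrite adjZ adjM conj_complexNi -scalemxAr mulmxA.
    apply: mxderiv_eq (mxderivM (mxderivM (dEi x) (dS x x1))
      (mxderiv_adj (dEi x))); first by [].
    (* Here Q' = -i (alpha Q - Q alpha^H) + w w^H - theta_2 theta_2^H, and [Qid] turns the first
       term into w w^H + theta_2 theta_2^H. *)
    rewrite mulmxDl mulmxBr mulmxBl AA BB h1 h2.
    move: (Qid x x1) => /(canRL (subrK _)) ->.
    rewrite scalerDr !scaleNr mul_complexi opprK.
    move: (Ei x *m A x *m _) ('i%C *: _) (theta2 *m _) => X1 X2 X3.
    by apply/matrixP => i j; rewrite !mxE; ring.
  by have [Sh _] := Sprop x x1; rewrite !adjM trmxCK Sh mulmxA.
- move=> x x0 Qu.
  have Su : S x \in unitmx by move: Qu; rewrite !unitmx_mul => /andP[/andP[]].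
  have -> : invmx (Ei x *m S x *m (Ei x) ^t*) = (E x) ^t* *m invmx (S x) *m E x.
    rewrite -[LHS]mulmx1; set Y := _ *m E x.
    have -> : 1%:M = Ei x *m S x *m (Ei x) ^t* *m Y; last by rewrite mulKmx.
    by rewrite /Y !mulmxA -(mulmxA _ ((Ei x) ^t*)) EKadj mulmx1 mulmxK// EiK.
  (* e^(ix alpha^H) is the adjoint of e^(-ix alpha); in w^H Q^(-1) one of the two factors Ei^H then
     cancels against E^H. *)
  have e : expmx (('i%C * x%:C) *: alpha ^t*) = (Ei x) ^t*.
    by rewrite EiE expmx_adj adjZ conj_complexNiM.
  rewrite /potential e (SE x x0) -EE; congr (2 *: _); rewrite adjM AE adjM.
  by rewrite !mulmxA -(mulmxA _ ((Ei x) ^t*) ((E x) ^t*)) EKadj mulmx1.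
Qed.

End Gramian.
End Potential.

(** * Decay *)

(** The computation of b', with V = w^H, W = w and T = theta_2 theta_2^H: as (2i)(-i) = 2, the terms
    in V P W V P cancel. *)
Lemma gramian_quotient_algebra (R : realType) m n (alpha P T : 'M[R[i]]_n)
    (V : 'M[R[i]]_(m, n)) (W : 'M[R[i]]_(n, m)) :
  (2 * 'i%C) *: (V *m (P *m alpha - 'i%C *: (P *m (W *m V + T) *m P))) +
    V *m (- 2 *: (P *m W *m (V *m P))) =
  V *m P *m ((2 * 'i%C) *: alpha + 2 *: (T *m P)).
Proof.
rewrite !mulmxBr !mulmxDr mulmxDl -!scalemxAr mulmxDr !mulmxA.
move: (V *m P *m alpha) (V *m P *m W *m V *m P) (V *m P *m T *m P) => X1 X2 X3.
by apply/matrixP => i j; rewrite !mxE; ring: (sqr_i R).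
Qed.

Section Decay.
Context {R : realType}.
Implicit Types x t : R.
Variables (n m1 m2 : nat) (alpha S0 : 'M[R[i]]_n).
Variables (theta2 : 'M[R[i]]_(n, m2)).
Variables (w : R -> 'M[R[i]]_(n, m1)) (Q : R -> 'M[R[i]]_n).
Hypothesis S0pos : posdefmx S0.
Hypothesis Q0 : Q 0 = S0.
Hypothesis dw : forall x, mxderiv x w (- (2 * 'i%C) *: (alpha *m w x)).
Hypothesis dQ : forall x, -1 < x -> mxderiv x Q (2 *: (w x *m (w x) ^t*)).
Hypothesis Qherm : forall x, -1 < x -> (Q x) ^t* = Q x.
Hypothesis Qid : forall x, -1 < x -> alpha *m Q x - Q x *m alpha ^t* =
  'i%C *: (w x *m (w x) ^t* + theta2 *m theta2 ^t*).

Let N1 x : 0 <= x -> -1 < x.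
Proof. by apply: lt_le_trans; rewrite ltrN10. Qed.

(** For a row y the form y Q y^H has derivative 2 |y w|^2 >= 0, so it stays above its initial value
    y S_0 y^H. *)
Lemma gramian_bound : exists2 lambda : R, 0 < lambda &
  forall x, 0 <= x -> forall m (Y : 'M[R[i]]_(m, n)) k,
    lambda * \sum_l sqnormc (Y k l) <= complex.Re ((Y *m Q x *m Y ^t*) k k).
Proof.
have [lambda lambda0 S0ge] := posdefmx_bound S0pos.
exists lambda => // x x0 m Y k; apply: le_trans (S0ge _ Y k) _; rewrite -Q0.
pose q t := complex.Re ((Y *m Q t *m Y ^t*) k k).
have dq t : -1 < t ->
    is_derive t (1 : R) q (2 * \sum_l sqnormc ((Y *m w t) k l)).
  move=> t1; have [dt _] := mxderivMr (Y ^t*) (mxderivMl Y (dQ t1)) k k.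
  apply: is_derive_eq dt _.
  have -> : Y *m (2 *: (w t *m (w t) ^t*)) *m Y ^t* =
      2 *: ((Y *m w t) *m (Y *m w t) ^t*).
    by rewrite adjM -scalemxAr -scalemxAl !mulmxA.
  by rewrite mxE -[2 : R[i]](rmorph_nat (real_complex R)) complex_ReZ
    Re_mulmx_adj.
have [c _ E] := MVT_ray dq (N1 (lexx 0)) x0.
rewrite -subr_ge0 -/(q x) -/(q 0) E subr0 mulr_ge0// mulr_ge0//.
by apply: sumr_ge0 => l _; exact: sqnormc_ge0.
Qed.

(** The lower bound, applied to a basis of the left kernel, forces its rows to vanish. *)
Lemma gramian_unit x : 0 <= x -> Q x \in unitmx.
Proof.
move=> x0; have [lambda lambda0 Qge] := gramian_bound.
rewrite -row_free_unit -kermx_eq0; have := mulmx_ker (Q x).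
move: (kermx _) => Y YQ; apply/eqP/matrixP => k l.
have := Qge x x0 _ Y k; rewrite YQ mul0mx !mxE pmulr_rle0//.
rewrite (bigD1 l)//= => sle0.
have : sqnormc (Y k l) <= 0.
  by apply: le_trans sle0; rewrite lerDl sumr_ge0// => ? _; exact: sqnormc_ge0.
rewrite le_eqVlt ltNge sqnormc_ge0 orbF paddr_eq0 ?sqr_ge0// !sqrf_eq0.
by case: (Y k l) => u v /= /andP[/eqP -> /eqP ->].
Qed.

Let P x := invmx (Q x).
Let b x := (w x) ^t* *m P x.

Let Pherm x : 0 <= x -> (P x) ^t* = P x.
Proof. by move=> x0; rewrite /P adj_inv Qherm ?N1. Qed.

Let badj x : 0 <= x -> (b x) ^t* = P x *m w x.
Proof. by move=> x0; rewrite /b adjM trmxCK Pherm. Qed.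

Let dP x : 0 < x -> mxderiv x P (- 2 *: ((b x) ^t* *m b x)).
Proof.
move=> x0.
(* Invertibility is known for nonnegative arguments, so x > 0 provides a full neighbourhood. *)
have Qu : \forall t \near x, Q t \in unitmx.
  have : \forall t \near x, 0 < t.
    by apply: open_nbhs_nbhs; split => //; exact: open_gt.
  by apply: filterS => t /ltW; exact: gramian_unit.
have := mxderiv_inv Qu (dQ (N1 (ltW x0))).
apply: mxderiv_eq => //.
by rewrite badj ?ltW// /b -scalemxAr -scalemxAl scaleNr !mulmxA.
Qed.

Let db x : 0 < x -> mxderiv x b
  (b x *m ((2 * 'i%C) *: alpha + 2 *: (theta2 *m theta2 ^t* *m P x))).
Proof.
move=> x0; apply: mxderiv_eq (mxderivM (mxderiv_adj (dw x)) (dP x0)) => //.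
have x1 := N1 (ltW x0); have Qu := gramian_unit (ltW x0).
(* The identity for [Q], multiplied by [P] on both sides, lets [alpha] pass through [P]. *)
have alphaP : alpha ^t* *m P x = P x *m alpha -
    'i%C *: (P x *m (w x *m (w x) ^t* + theta2 *m theta2 ^t*) *m P x).
  rewrite scalemxAl scalemxAr -Qid// mulmxBr mulmxBl !mulmxA /P mulVmx// mul1mx.
  by rewrite mulmxK// opprB addrC subrK.
have conj2i : Num.conj (- (2 * 'i%C) : R[i]) = 2 * 'i%C.
  by apply/eqP; rewrite eq_complex mulr_natl mulr2n/= !addr0 oppr0 opprK !eqxx.
rewrite adjZ adjM conj2i.
rewrite -scalemxAl -(mulmxA _ (alpha ^t*)) alphaP badj ?ltW// /b.
exact: gramian_quotient_algebra.
Qed.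

Let bounded_of_sq m p (F : R -> 'M[R[i]]_(m, p)) K :
  (forall x, 0 < x -> forall i, \sum_j sqnormc (F x i j) <= K) -> mxbounded F.
Proof.
move=> H; exists (K + 1) => x x0 i j.
rewrite (le_trans (norm1c_le_sqnormc _))// lerD2r (le_trans _ (H x x0 i))//.
by rewrite (bigD1 j)//= lerDl sumr_ge0// => ? _; exact: sqnormc_ge0.
Qed.

(** The lower bound at Y = P, where P Q P^H = P. *)
Let P_diag lambda x i : (forall m (Y : 'M[R[i]]_(m, n)) k,
    lambda * \sum_l sqnormc (Y k l) <= complex.Re ((Y *m Q x *m Y ^t*) k k)) ->
  0 <= x -> lambda * \sum_j sqnormc (P x i j) <= complex.Re (P x i i).
Proof.
move=> Qge x0; have := Qge _ (P x) i.
by rewrite Pherm// mulVmx ?gramian_unit// mul1mx.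
Qed.

(** With p = Re P_ii, [P_diag] gives lambda p^2 <= p, hence lambda p <= 1; used once more, it bounds
    the squared norm of the row by lambda^(-2). *)
Let P_bounded : mxbounded P.
Proof.
have [lambda lambda0 Qge] := gramian_bound.
apply: (@bounded_of_sq _ _ _ (lambda ^- 2)) => x x0 i.
have := P_diag i (Qge x (ltW x0)) (ltW x0).
have : sqnormc (P x i i) <= \sum_j sqnormc (P x i j).
  by rewrite (bigD1 i)//= lerDl sumr_ge0// => ? _; exact: sqnormc_ge0.
have : complex.Re (P x i i) ^+ 2 <= sqnormc (P x i i).
  by rewrite lerDl sqr_ge0.
set p := complex.Re _; set s := sqnormc _; set S := \sum_j _ => ps sS Sp.
have p0 : 0 <= p.
  by apply: le_trans Sp; rewrite mulr_ge0 ?(ltW lambda0)// /S sumr_ge0// =>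
    ? _; exact: sqnormc_ge0.
have lp : lambda * p <= 1.
  have [->|pn0] := eqVneq p 0; first by rewrite mulr0.
  have p_gt0 : 0 < p by rewrite lt_neqAle eq_sym pn0.
  rewrite -(ler_pM2r p_gt0) mul1r -mulrA -expr2.
  by apply: le_trans Sp; rewrite ler_wpM2l ?(ltW lambda0)//; exact: le_trans sS.
have : lambda ^+ 2 * S <= 1.
  by apply: le_trans lp; rewrite expr2 -mulrA ler_wpM2l ?(ltW lambda0).
by rewrite -ler_pdivlMl ?exprn_gt0// mulr1.
Qed.

Let b_bounded : mxbounded b.
Proof.
have [lambda lambda0 Qge] := gramian_bound.
(* [c] is the constant value of tr (w^H P w) + tr (theta_2^H P theta_2); since b Q b^H = w^H P w, it
   bounds lambda times the squared norm of each row of [b]. *)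
pose c := complex.Re (- 'i%C * (\tr alpha - \tr (alpha ^t*))).
apply: (@bounded_of_sq _ _ _ (c / lambda)) => x x0 i.
have x0' := ltW x0; have Qu := gramian_unit x0'.
rewrite ler_pdivlMr// mulrC (le_trans (Qge x x0' _ (b x) i))//.
(* A general [Y], because positivity of the diagonal is needed for both [w] and [theta2]. *)
have E1 m (Y : 'M[R[i]]_(n, m)) :
  Y ^t* *m P x *m Q x *m (Y ^t* *m P x) ^t* = Y ^t* *m P x *m Y.
  by rewrite adjM trmxCK Pherm// mulmxKV// mulmxA.
have tr_ge m (Y : 'M[R[i]]_(n, m)) k :
  0 <= complex.Re ((Y ^t* *m P x *m Y) k k).
  rewrite -E1; apply: le_trans (Qge x x0' _ (Y ^t* *m P x) k).
  by rewrite mulr_ge0 ?(ltW lambda0)// sumr_ge0// => ? _; exact: sqnormc_ge0.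
(* Cyclicity of the trace: tr (P (alpha Q - Q alpha^H)) = tr alpha - tr alpha^H. *)
have -> : c = complex.Re (\tr ((w x) ^t* *m P x *m w x)) +
    complex.Re (\tr (theta2 ^t* *m P x *m theta2)).
  rewrite -cReD -!(mulmxA (_ ^t*)) !(mxtrace_mulC (_ ^t*)) -!mulmxA -mxtraceD
    -mulmxDr.
  have : 'i%C *: (w x *m (w x) ^t* + theta2 *m theta2 ^t*) =
      alpha *m Q x - Q x *m alpha ^t*.
    by rewrite Qid ?N1.
  move=> /(congr1 (fun X => - 'i%C *: X)).
  rewrite scalerA mulNr -expr2 sqr_i opprK scale1r => ->.
  rewrite -scalemxAr mxtraceZ mulmxBr raddfB /= !mulmxA /P mulVmx// mul1mx.
  by rewrite -mulmxA mxtrace_mulC mulmxK.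
rewrite /b E1 /mxtrace !raddf_sum/= (bigD1 i)//= -addrA lerDl addr_ge0//.
  by apply: sumr_ge0 => k _; exact: tr_ge.
by apply: sumr_ge0 => k _; exact: tr_ge.
Qed.

Lemma gramian_quotient_cvg0 : mxcvg (+oo : set_system R) b 0.
Proof.
(* [D] is b', so the next bound controls the second derivative of [P]. *)
pose D x := b x *m ((2 * 'i%C) *: alpha + 2 *: (theta2 *m theta2 ^t* *m P x)).
have [K HK] : mxbounded (fun x => - 2 *: ((D x) ^t* *m b x + (b x) ^t* *m D x)).
  have Db : mxbounded D.
    apply: mxboundedM => //; apply: mxboundedD; first exact: mxbounded_cst.
    by apply: mxboundedZ; apply: mxboundedM => //; exact: mxbounded_cst.
  apply: mxboundedZ; apply: mxboundedD; apply: mxboundedM => //;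
    exact: mxbounded_adj.
(* Barbalat's lemma for Re P_ll, whose derivative is -2 times the squared norm of column l of
   [b]. *)
have main l : (- 2 * \sum_k sqnormc (b x k l)) @[x --> +oo] --> 0.
  have ReE x : complex.Re ((- 2 *: ((b x) ^t* *m b x)) l l) =
      - 2 * \sum_k sqnormc (b x k l).
    rewrite mxE -[2 : R[i]](rmorph_nat (real_complex R)) -rmorphN complex_ReZ.
    rewrite -[X in _ *m X]trmxCK Re_mulmx_adj; congr (_ * _);
      apply: eq_bigr => k _.
    by rewrite !mxE /sqnormc cReJ cImJ sqrrN.
  apply: (@cvg_derive_nonincreasing _ (fun x => complex.Re (P x l l)) _
    (fun x => complex.Re ((- 2 *: ((D x) ^t* *m b x + (b x) ^t* *m D x)) l l))
    K).
  - by move=> x x0; rewrite -ReE; have [] := dP x0 l l.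
  - move=> x x0; under eq_fun do rewrite -ReE.
    by have [] := mxderivZ (- 2) (mxderivM (mxderiv_adj (db x0)) (db x0)) l l.
  - move=> x x0; have [lambda lambda0 Qge] := gramian_bound.
    apply: le_trans (P_diag l (Qge x (ltW x0)) (ltW x0)).
    by rewrite mulr_ge0 ?(ltW lambda0)// sumr_ge0// => ? _; exact: sqnormc_ge0.
  - by move=> x x0; rewrite mulNr oppr_le0 mulr_ge0// sumr_ge0// => ? _;
      exact: sqnormc_ge0.
  - move=> x x0; apply: le_trans (HK x x0 l l).
    by apply: (le_trans (ler_norm _)); rewrite lerDl.
have small (e : R) k l : 0 < e ->
  \forall x \near +oo, sqnormc (b x k l) < e ^+ 2.
  move=> e0; have e20 : 0 < 2 * e ^+ 2 by rewrite mulr_gt0// exprn_gt0.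
  have /cvgrPdist_lt/(_ _ e20) := main l; apply: filterS => x.
  rewrite sub0r mulNr opprK ger0_norm; last first.
    by rewrite mulr_ge0// sumr_ge0// => ? _; exact: sqnormc_ge0.
  rewrite ltr_pM2l//; apply: le_lt_trans.
  by rewrite (bigD1 k)//= lerDl sumr_ge0// => ? _; exact: sqnormc_ge0.
move=> k l; rewrite mxE; split; apply/cvgrPdist_lt => e e0;
  have := small e k l e0; apply: filterS => x xe;
  rewrite sub0r normrN -(ltr_pXn2r (n := 2)) ?nnegrE ?(ltW e0)//
    real_normK ?num_real//;
  apply: le_lt_trans xe.
  by rewrite lerDl sqr_ge0.
by rewrite lerDr sqr_ge0.
Qed.

End Decay.

Theorem corollary3p6 (R : realType) (m1 m2 : nat)
    (v : R -> 'M[R[i]]_(m1, m2)) (hv : pseudo_exponential v) :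
  v x @[x --> +oo] --> (0 : 'M[R[i]]_(m1, m2)).
Proof.
have [n [alpha [S0 [theta1 [theta2 [adm vE]]]]]] := hv.
(* The reflexivity proofs instantiate the abstract [E], [Ei], [A] and [B] by the exponentials
   themselves. *)
have [w [Q [Q0 dw Qprop potE]]] := gramian_exists adm (fun=> erefl)
  (fun=> erefl) (fun=> erefl) (fun=> erefl).
have S0pos := adm.1.
have dQ x : -1 < x -> mxderiv x Q (2 *: (w x *m (w x) ^t*)) by move=> /Qprop[].
have Qherm x : -1 < x -> (Q x) ^t* = Q x by move=> /Qprop[].
have Qid x : -1 < x -> alpha *m Q x - Q x *m alpha ^t* =
  'i%C *: (w x *m (w x) ^t* + theta2 *m theta2 ^t*) by move=> /Qprop[].
have := gramian_quotient_cvg0 S0pos Q0 dw dQ Qherm Qid.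
move=> /(mxcvgMr (2 *: theta2))/cvg_mxcvg.
(* [v] agrees with 2 b theta_2 for x >= 0 only, which is enough near +oo. *)
rewrite mul0mx; apply: cvg_trans; apply: near_eq_cvg.
near=> x.
have x0 : 0 <= x by near: x; apply: nbhs_pinfty_ge; rewrite num_real.
rewrite vE// potE//; first by rewrite -scalemxAr.
exact: (gramian_unit S0pos Q0 dQ).
Unshelve. all: by end_near. Qed.
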